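(* Let $q\ge 2$ be an integer and let $\mathfrak{n}$ be the real Lie algebra with basis $\{X_i, Y_k, Z_l : 1\le i\le 2q,\ 1\le k\le q,\ 1\le l\le q+2\}$ whose only nonzero brackets among basis elements (up to skew-symmetry) are $$[X_{iq+j},Y_j]=Z_{q+i+1}\quad (i=0,1,\ 1\le j\le q),\qquad [X_j,X_{j+q}]=Z_j\quad (1\le j\le q).$$ Then $\mathfrak{n}$ is a two-step nilpotent Anosov Lie algebra of type $(3q,\,q+2)$.
   Context: A real Lie algebra of dimension $n$ is called Anosov if it admits a Lie algebra automorphism $\tau$ that is hyperbolic (none of its complex eigenvalues has modulus $1$) and such that the matrix of $\tau$ lies in $\mathrm{GL}_n(\mathbb{Z})$ with respect to some $\mathbb{Z}$-basis, i.e. a basis with integer structure constants. The type of a nilpotent Lie algebra $\mathfrak{n}$ is the tuple $(n_1,\dots,n_r)$ with $n_i=\dim C^{i-1}(\mathfrak{n})/C^i(\mathfrak{n})$, where $C^0(\mathfrak{n})=\mathfrak{n}$, $C^{i}(\mathfrak{n})=[\mathfrak{n},C^{i-1}(\mathfrak{n})]$ is the descending central series, and $C^r(\mathfrak{n})=0\ne C^{r-1}(\mathfrak{n})$. *)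

(* Defs.v *)
From HB Require Import structures.
From mathcomp Require Import all_boot all_order all_algebra.
From mathcomp Require Import sesquilinear complex reals.
Set Implicit Arguments.
Unset Strict Implicit.
Unset Printing Implicit Defensive.
Import Order.TTheory GRing.Theory Num.Theory.
Local Open Scope ring_scope.

Section LieAlgebra.
Variables (R : realType) (V : vectType R).
Implicit Type br : {bilinear V -> V -> V}.

Definition alternating br := forall u, br u u = 0.

Definition jacobi br :=
  forall u v w, br u (br v w) + br v (br w u) + br w (br u v) = 0.

Definition lie_bracket br := alternating br /\ jacobi br.

(* By bilinearity, the brackets of basis vectors span [U, W]. *)
Definition brv br (U W : {vspace V}) : {vspace V} :=
  <<[seq br u w | u <- vbasis U, w <- vbasis W]>>%VS.

Definition lcs br (i : nat) : {vspace V} := iter i (brv br fullv) fullv.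

Definition nilpotent_of_step br (r : nat) :=
  (0 < r)%N /\ (lcs br r = 0%VS /\ lcs br r.-1 <> 0%VS).

(* lcs br i :\: lcs br i.+1 is a complement of C^{i+1} in C^i, so that its
   dimension is that of the quotient.  Entries are counted from 0. *)
Definition of_type br (s : seq nat) :=
  nilpotent_of_step br (size s) /\
  s = mkseq (fun i => \dim (lcs br i :\: lcs br i.+1)) (size s).

Definition lie_automorphism br (tau : 'End(V)) :=
  bijective tau /\ forall u v, tau (br u v) = br (tau u) (tau v).

Definition mx_in_basis (b : (\dim {:V}).-tuple V) (tau : 'End(V)) :
    'M[R]_(\dim {:V}) :=
  \matrix_(i, j) coord b i (tau (tnth b j)).

Definition hyperbolic (tau : 'End(V)) :=
  let M := mx_in_basis (vbasis {:V}) tau in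
  forall z : R[i], eigenvalue (map_mx (real_complex R) M) z -> `|z| != 1.

Definition Zbasis br (b : (\dim {:V}).-tuple V) :=
  basis_of {:V} b /\
  forall i j k, coord b k (br (tnth b i) (tnth b j)) \is a Num.int.

(* unitmx over int means invertible over int, i.e. determinant 1 or -1. *)
Definition integral_unimodular (b : (\dim {:V}).-tuple V) (tau : 'End(V)) :=
  exists2 M : 'M[int]_(\dim {:V}),
    M \in unitmx & mx_in_basis b tau = map_mx intr M.

Definition anosov br :=
  lie_bracket br /\
  exists tau : 'End(V), [/\ lie_automorphism br tau, hyperbolic tau
    & exists2 b, Zbasis br b & integral_unimodular b tau].

(* The families X, Y, Z are indexed from 1; their values outside the ranges
   1..2q, 1..q, 1..q+2 are irrelevant. *)
Definition XYZ (q : nat) (X Y Z : nat -> V) : seq V :=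
  [seq X i | i <- iota 1 (2 * q)%N] ++ [seq Y k | k <- iota 1 q] ++
  [seq Z l | l <- iota 1 (q + 2)%N].

Definition listed (q : nat) (X Y Z : nat -> V) (u v w : V) :=
  (exists i j : nat, [/\ (i < 2)%N, (1 <= j <= q)%N
     & [/\ u = X (i * q + j)%N, v = Y j & w = Z (q + i + 1)%N]]) \/
  (exists2 j : nat, (1 <= j <= q)%N
     & [/\ u = X j, v = X (j + q)%N & w = Z j]).

Record presented (q : nat) br (X Y Z : nat -> V) : Prop := Presented {
  presented_basis : basis_of {:V} (XYZ q X Y Z);
  presented_bracket : forall u v w, listed q X Y Z u v w -> br u v = w;
  presented_only : {in XYZ q X Y Z &, forall u v, br u v <> 0 ->
    exists w, listed q X Y Z u v w \/ listed q X Y Z v u w}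
}.

End LieAlgebra.

(* Main.v *)
Require Import Defs.
From mathcomp Require Import all_boot all_order all_algebra.
From mathcomp Require Import sesquilinear complex reals.
From mathcomp Require Import zify ring lra polyrcf.
Set Implicit Arguments.
Unset Strict Implicit.
Unset Printing Implicit Defensive.
Import Order.TTheory GRing.Theory Num.Theory.
Local Open Scope ring_scope.

(* Let K = Q[t]/(f) with f monic integral of degree q, f(0) = 1 or -1, and q
   distinct real roots x_j; let y_0, y_1 be the roots of t^2 - m t + 1 for a
   large m.  Up to rescaling the Z_j, the algebra is the real form of the
   rational algebra (K (x) Q^2) + K + K + Q^2 with brackets
   [k (x) w, k'] = Tr(k k') w and [k (x) w, k' (x) w'] = k k' (w /\ w'), each
   K (x) R being split into q lines by the embeddings t |-> x_j.  Multiplication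
   by t on the Y-part extends to an automorphism that is diagonal in the given
   basis, with eigenvalues y_i / x_j on X_(iq+j), x_j on Y_j, x_j^-2 on Z_j and
   y_i on Z_(q+i+1); it and its inverse preserve the lattice spanned by the
   powers of t and of y.  The eigenvalues are real and, for m large, of modulus
   different from 1. *)

(** * Integer polynomials evaluated at roots, and the existence of units *)

Section IntegralFunctions.
Variable R : realType.
Implicit Types (n : nat) (x h : nat -> R) (f : {poly int}).

(** The condition f(0) = 1 or -1 makes t a unit of Z[t]/(f), and the distinct real roots split
    R[t]/(f) into n lines. The tuple [x] is extended arbitrarily beyond [n]. *)
Definition unit_roots n x f :=
  [/\ f \is monic, size f = n.+1, f`_0 ^+ 2 = 1,
      (forall i j, (i < n)%N -> (j < n)%N -> x i = x j -> i = j)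
    & forall j, (j < n)%N -> root (map_poly intr f) (x j)].

(* The image of Z[t] in R^n under evaluation at the n-tuple x. *)
Definition Zfun n x h :=
  exists p : {poly int}, forall j, (j < n)%N -> h j = (map_poly intr p).[x j].

Lemma Zfun_exp n x m : Zfun n x (fun j => x j ^+ m).
Proof. by exists 'X^m => j _; rewrite map_polyXn hornerXn. Qed.

Lemma Zfun_id n x : Zfun n x x.
Proof. by exists 'X => j _; rewrite map_polyX hornerX. Qed.

Lemma Zfun_mul n x g h : Zfun n x g -> Zfun n x h ->
  Zfun n x (fun j => g j * h j).
Proof.
move=> [p hp] [r hr]; exists (p * r) => j jn.
by rewrite rmorphM hornerM hp ?hr.
Qed.

Lemma Zfun_sqr n x h : Zfun n x h -> Zfun n x (fun j => h j ^+ 2).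
Proof. by move=> zh; exact: Zfun_mul. Qed.

Section Roots.
Variables (n : nat) (x : nat -> R) (f : {poly int}).
Hypothesis xf : unit_roots n x f.

Lemma unit_roots_horner j : (j < n)%N -> (map_poly intr f).[x j] = 0 :> R.
Proof. by case: xf => _ _ _ _ H /H /rootP. Qed.

Lemma unit_roots_neq0 j : (j < n)%N -> x j != 0.
Proof.
case: xf => _ _ f01 _ _ jn; apply/eqP => x0.
have := unit_roots_horner jn; rewrite x0 horner_coef0 coef_map /= => /eqP.
by rewrite intr_eq0 => /eqP H; move: f01; rewrite H expr0n.
Qed.

(* f = f_0 + t g with f_0 = 1 or -1, so -f_0 g is an inverse of t modulo f. *)
Lemma Zfun_inv : Zfun n x (fun j => (x j)^-1).
Proof.
case: xf => _ _ f01 _ _.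
exists (- f`_0 *: drop_poly 1 f) => j jn.
have H : (f`_0)%:~R + (map_poly intr (drop_poly 1 f)).[x j] * x j = 0.
  have -> : (f`_0)%:~R = (map_poly intr (take_poly 1 f)).[x j] :> R.
    have -> : take_poly 1 f = (f`_0)%:P.
      by apply/polyP => -[|i]; rewrite coef_take_poly coefC.
    by rewrite map_polyC hornerC.
  rewrite -(unit_roots_horner jn) -[f in RHS](poly_take_drop 1) rmorphD rmorphM /=.
  by rewrite map_polyXn hornerD hornerM hornerXn.
rewrite map_polyZ hornerZ.
have H1 : (f`_0)%:~R ^+ 2 = 1 :> R by rewrite -rmorphXn f01.
set g := (X in _ = _ * X.[_]); set a := ((f`_0)%:~R : R) in H H1.
have E : (- a * g.[x j]) * x j = 1.
  have -> : - a * g.[x j] * x j = a ^+ 2 - a * (a + g.[x j] * x j) by ring.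
  by rewrite H mulr0 subr0.
by apply: (mulIf (unit_roots_neq0 jn)); rewrite rmorphN E mulVf ?unit_roots_neq0.
Qed.

(** Division by the monic f stays over the integers; since f vanishes at the x_j, only the
    remainder, of degree below n, contributes. *)
Lemma Zfun_reduce h : Zfun n x h -> exists c : nat -> int,
  forall j, (j < n)%N -> h j = \sum_(k < n) (c k)%:~R * x j ^+ k.
Proof.
case: xf => fm sf _ _ _ [p hp].
exists (fun k => (Pdiv.CommonRing.rmodp p f)`_k) => j jn.
rewrite hp // [p in LHS](Pdiv.RingMonic.rdivp_eq fm) rmorphD rmorphM /=.
rewrite hornerD hornerM unit_roots_horner // mulr0 add0r.
rewrite (@horner_coef_wide _ n); first by apply: eq_bigr => k _; rewrite coef_map.
apply: leq_trans (size_poly _ _) _.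
by rewrite -ltnS -sf Pdiv.CommonRing.ltn_rmodpN0 // monic_neq0.
Qed.

(** Distinct roots make the Vandermonde matrix invertible. The inverse is indexed by naturals to
    match tuples given as functions. *)
Lemma Vandermonde_inverse : exists U : nat -> nat -> R,
  (forall j j', (j < n)%N -> (j' < n)%N ->
    \sum_(k < n) x j ^+ k * U k j' = (j == j')%:R) /\
  (forall k k', (k < n)%N -> (k' < n)%N ->
    \sum_(j < n) U k j * x j ^+ k' = (k == k')%:R).
Proof.
case: xf => _ _ _ xI _.
pose W := (Vandermonde n (\row_(j < n) x j))^T.
have Wu : W \in unitmx.
  rewrite unitmx_tr unitmxE det_Vandermonde unitfE.
  apply/prodf_neq0 => i _; apply/prodf_neq0 => j ij; rewrite !mxE subr_eq0.
  by apply/eqP => /(xI _ _ (ltn_ord _) (ltn_ord _)) E; rewrite E ltnn in ij.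
(* Turning a natural into an ordinal needs a default element of ['I_n], hence the separate case n =
   0. *)
have [n0|n0] := posnP n.
  by exists (fun _ _ => 0); split=> j j'; rewrite n0.
pose o (k : nat) : 'I_n := insubd (Ordinal n0) k.
have oE k (kn : (k < n)%N) : o k = Ordinal kn.
  by apply: val_inj; rewrite val_insubd kn.
exists (fun k j => invmx W (o k) (o j)); split=> i j ilt jlt.
  have := congr1 (fun M : 'M_n => M (Ordinal ilt) (Ordinal jlt)) (mulmxV Wu).
  rewrite !mxE -val_eqE /= => <-; apply: eq_bigr => k _; rewrite !mxE.
  by rewrite (oE _ (ltn_ord k)) (oE _ jlt); congr (_ * invmx W _ _); apply: val_inj.
have := congr1 (fun M : 'M_n => M (Ordinal ilt) (Ordinal jlt)) (mulVmx Wu).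
rewrite !mxE -val_eqE /= => <-; apply: eq_bigr => k _; rewrite !mxE.
by rewrite (oE _ (ltn_ord k)) (oE _ ilt); congr (invmx W _ _ * _); apply: val_inj.
Qed.

(* The sum is the trace of the integer matrix of multiplication by h in the
   basis 1, t, .., t^(n-1) of Z[t]/(f). *)
Lemma Zfun_sum h : Zfun n x h -> \sum_(j < n) h j \is a Num.int.
Proof.
move=> zh; have [U [xU Ux]] := Vandermonde_inverse.
suff -> : \sum_(j < n) h j =
    \sum_(k < n) \sum_(j < n) U k j * (h j * x j ^+ k).
  apply: rpred_sum => k _.
  have [c hc] := Zfun_reduce (Zfun_mul zh (@Zfun_exp n x k)).
  rewrite (_ : \sum_(j < n) _ = (c k)%:~R) ?intr_int //.
  transitivity (\sum_(l < n) (c l)%:~R * \sum_(j < n) U k j * x j ^+ l).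
    under [RHS]eq_bigr => l _ do rewrite mulr_sumr.
    rewrite exchange_big; apply: eq_bigr => j _ /=.
    by rewrite hc // mulr_sumr; apply: eq_bigr => l _; rewrite mulrCA.
  rewrite (bigD1 k) //= Ux // eqxx mulr1 big1 ?addr0 // => l.
  by rewrite Ux // -val_eqE eq_sym => /negPf /= ->; rewrite mulr0.
rewrite exchange_big; apply: eq_bigr => j _ /=.
under eq_bigr => k _ do rewrite mulrCA [U _ _ * _]mulrC.
by rewrite -mulr_sumr xU // eqxx mulr1.
Qed.

End Roots.

(** Take f = g + 1 with g the product of the t - 4k for k < q. The root 0 of g gives f(0) = 1, and
    adding 1 is too small a change to destroy the sign changes of g between its roots. *)
Lemma totally_real_unit_exists q : (2 <= q)%N -> exists x f,
  unit_roots q x f /\ forall j, (j < q)%N -> x j ^+ 2 != 1.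
Proof.
move=> q2; pose g : {poly int} := \prod_(k < q) ('X - (4 * k%:Z)%:P).
have gm : g \is monic by apply: monic_prod => k _; exact: monicXsubC.
have sg : size g = q.+1 by rewrite size_prod_XsubC /index_enum -enumT size_enum_ord.
pose f := g + 1.
have sf : size f = q.+1 by rewrite size_polyDl // sg size_poly1; lia.
have fm : f \is monic.
  by rewrite monicE lead_coefDl -?monicE // sg size_poly1; lia.
have gE (R' : comNzRingType) (t : int) :
    (map_poly intr g).[t%:~R] = (\prod_(k < q) (t - 4 * k%:Z))%:~R :> R'.
  rewrite rmorph_prod horner_prod [RHS]rmorph_prod; apply: eq_bigr => k _.
  by rewrite rmorphB /= map_polyX map_polyC hornerXsubC /= rmorphB.
pose G (t : int) := \prod_(k < q) (t - 4 * k%:Z).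
have fE t : (map_poly intr f).[t%:~R] = (G t + 1)%:~R :> R.
  by rewrite rmorphD /= rmorph1 hornerD hornerC gE rmorphD.
have q0 : (0 < q)%N by lia.
have f0 : f`_0 = 1.
  rewrite coefD coef1 -[g`_0]horner_coef0 horner_prod.
  by rewrite (bigD1 (Ordinal q0)) //= !hornerE.
(* These points lie halfway between the roots 4k of g, with one more beyond each end. Every factor
   of g has modulus at least 2 there. *)
pose t (i : nat) : int := 4 * i%:Z - 2.
have Gbig i : 1 < `|G (t i)|.
  rewrite normr_prod (bigD1 (Ordinal q0)) //=.
  have : 0 < \prod_(k < q | k != Ordinal q0) `|t i - 4 * k%:Z|.
    by apply: prodr_gt0 => k _; rewrite /t; lia.
  have : 2 <= `|t i - 4 * (Ordinal q0)%:Z| by rewrite /t /=; lia.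
  by move: `|_ - _| (\prod_(_ < _ | _) _) => a b; nia.
have Gsign i : (i < q)%N -> G (t i) * G (t i.+1) < 0.
  (* From t_i to t_(i+1) only the factor with k = i changes sign. *)
  move=> iq; rewrite -big_split (bigD1 (Ordinal iq)) //=.
  rewrite nmulr_rlt0; last by rewrite /t; lia.
  apply: prodr_gt0 => k; rewrite -val_eqE /= => ki; rewrite /t.
  by have [H|H] : (k < i)%N \/ (i < k)%N; [lia|nia|nia].
have roots i : (i < q)%N -> exists2 z : R,
    (t i)%:~R < z < (t i.+1)%:~R & root (map_poly intr f) z.
  move=> iq; have [||z] := @poly_ivtoo R (map_poly intr f) (t i)%:~R (t i.+1)%:~R.
  - by rewrite ler_int /t; lia.
  - rewrite !fE -rmorphM /= -[0]/((0 : int)%:~R) ltr_int.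
    have := Gbig i; have := Gbig i.+1; have := Gsign i iq.
    by move: (G _) (G _) => a b; nia.
  by rewrite in_itv /=; exists z.
have [x hx] : exists x : nat -> R, forall i, (i < q)%N ->
    (t i)%:~R < x i < (t i.+1)%:~R /\ root (map_poly intr f) (x i).
  elim: {-2}q (leqnn q) => [_|m IH mq]; first by exists (fun=> 0).
  have [x hx] := IH (ltnW mq); have [z z1 z2] := roots m mq.
  exists (fun i => if i == m then z else x i) => i im.
  by case: eqP => [->|/eqP ne] //; apply: hx; lia.
exists x, f; split.
  split; rewrite ?f0 ?expr1n //; last by move=> j /hx [].
  have lt i j : (i < j)%N -> (j < q)%N -> x i < x j.
    move=> ij jq; have [/andP[_ h1] _] := hx i (ltn_trans ij jq).
    have [/andP[h2 _] _] := hx j jq.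
    apply: lt_le_trans h1 _; apply: le_trans (ltW h2).
    by rewrite ler_int /t; lia.
  move=> i j iq jq E; have [ij|ji|//] := ltngtP i j.
    by have := lt _ _ ij jq; rewrite E ltxx.
  by have := lt _ _ ji iq; rewrite E ltxx.
(* A root 1 or -1 of f would give g the value -1 there, although the factor with k = 1, present
   because q >= 2, is -3 or -5. *)
move=> j jq; apply/negP => /eqP.
rewrite -[1](expr1n _ 2) => /eqP; rewrite eqf_sqr => /orP[] /eqP xE;
  have [_ /rootP] := hx j jq; rewrite xE.
- rewrite -[1]/((1 : int)%:~R) fE => /eqP; rewrite intr_eq0 /G.
  by rewrite (bigD1 (Ordinal q2)) //=; lia.
- rewrite -[- 1]/((- 1 : int)%:~R) fE => /eqP; rewrite intr_eq0 /G.
  by rewrite (bigD1 (Ordinal q2)) //=; lia.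
Qed.

Lemma large_quadratic_unit_exists (B : R) : exists x f,
  [/\ unit_roots 2 x f, x 0%N * x 1%N = 1, 0 < x 1%N < 1 & B < x 0%N].
Proof.
pose m := (Num.truncn `|B|).+3.
have mB : `|B| + 2 < m%:R.
  have := truncnS_gt `|B|; rewrite /m -(addn2 _.+1) natrD; lra.
have B0 := normr_ge0 B; have B1 := ler_norm B.
pose d : R := Num.sqrt (m%:R ^+ 2 - 4).
have d2 : d ^+ 2 = m%:R ^+ 2 - 4 by rewrite sqr_sqrtr //; nra.
have d0 : 0 <= d by exact: sqrtr_ge0.
have dm : m%:R - 2 < d by nra.
have dm' : d < m%:R by nra.
pose x (i : nat) : R := if i == 0%N then (m%:R + d) / 2 else (m%:R - d) / 2.
pose f : {poly int} := 'X^2 - m%:R *: 'X + 1.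
have sf' : (size (- (m%:R *: 'X) + 1 : {poly int})%R < 3)%N.
  rewrite (leq_ltn_trans (size_polyD _ _)) // gtn_max size_polyN size_poly1 andbT.
  by rewrite (leq_ltn_trans (size_scale_leq _ _)) ?size_polyX.
have fE : f = 'X^2 + (- (m%:R *: 'X) + 1) by rewrite addrA.
have x01 : x 0%N * x 1%N = 1 by rewrite /x /=; nra.
exists x, f; split=> //.
- split.
  + by rewrite monicE fE lead_coefDl ?lead_coefXn // size_polyXn.
  + by rewrite fE size_polyDl size_polyXn.
  + by rewrite /f !coefD coefN coefZ coefX coefXn coef1 /= mulr0.
  + by case=> [|[|i]] // [|[|j]] // _ _; rewrite /x /= => E; exfalso; lra.
  + move=> j _; apply/rootP.
    rewrite /f rmorphD rmorphB /= map_polyZ map_polyXn map_polyX rmorph1 !hornerE.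
    by rewrite rmorph_nat /x; case: ifP => _; nra.
- by rewrite /x /=; lra.
- by rewrite /x /=; lra.
Qed.

End IntegralFunctions.

(** * Bases, eigenvalues and lattices *)

Section LinearAlgebra.
Variables (R : realType) (V : vectType R).
Implicit Types (br : {bilinear V -> V -> V}) (tau sigma : 'End(V)) (s : seq V).

Lemma span_ind (P : V -> Prop) s :
  P 0 -> (forall a u v, P u -> P v -> P (a *: u + v)) ->
  {in s, forall u, P u} -> {in <<s>>%VS, forall u, P u}.
Proof.
move=> P0 PD Ps u us; rewrite (@coord_span _ _ _ (in_tuple s) u us).
apply: big_ind => // [v w Pv Pw|i _]; first by rewrite -[v]scale1r; exact: PD.
by rewrite -[_ *: _]addr0; apply: PD => //; apply: Ps; exact: mem_nth.
Qed.

Lemma basis_ind (P : V -> Prop) s : basis_of fullv s ->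
  P 0 -> (forall a u v, P u -> P v -> P (a *: u + v)) ->
  {in s, forall u, P u} -> forall u, P u.
Proof.
by move=> sb P0 PD Ps u; apply: (span_ind P0 PD Ps); rewrite (span_basis sb) memvf.
Qed.

Lemma basis_ind2 (P : V -> V -> Prop) s : basis_of fullv s ->
  (forall v, P 0 v) -> (forall u, P u 0) ->
  (forall a u v w, P u w -> P v w -> P (a *: u + v) w) ->
  (forall a u v w, P w u -> P w v -> P w (a *: u + v)) ->
  {in s &, forall u v, P u v} -> forall u v, P u v.
Proof.
move=> sb P0l P0r PDl PDr Ps u v.
apply: (basis_ind (P := P^~ v) sb) => // [a w w'|w ws]; first exact: PDl.
by apply: (basis_ind (P := P w) sb) => // [a w1 w2|w1 w1s]; [exact: PDr|exact: Ps].
Qed.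

Lemma bilinear_in br s (T : {vspace V}) : basis_of fullv s ->
  {in s &, forall u v, br u v \in T} -> forall u v, br u v \in T.
Proof.
move=> sb H; apply: (basis_ind2 sb) => // [v|u|a u v w hu hv|a u v w hu hv].
- by rewrite linear0l mem0v.
- by rewrite linear0r mem0v.
- by rewrite linearDl linearZl_LR rpredD ?rpredZ.
- by rewrite linearDr linearZr_LR rpredD ?rpredZ.
Qed.

Lemma memv_brv br (U W : {vspace V}) u w :
  u \in U -> w \in W -> br u w \in brv br U W.
Proof.
move=> uU wW; rewrite (coord_vbasis uU) (coord_vbasis wW) linear_sumlz.
apply: rpred_sum => i _; rewrite linearZl_LR rpredZ // linear_sumr.
apply: rpred_sum => j _; rewrite linearZr_LR rpredZ // memv_span //.
by apply: allpairs_f; rewrite mem_nth // size_tuple.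
Qed.

Lemma brv_sub br (U W T : {vspace V}) :
  {in U & W, forall u w, br u w \in T} -> (brv br U W <= T)%VS.
Proof.
move=> H; apply/span_subvP => _ /allpairsP[[u w] /= [uU wW ->]].
by apply: H; exact: vbasis_mem.
Qed.

Lemma eq_on_basis tau sigma s : basis_of fullv s ->
  {in s, tau =1 sigma} -> forall u, tau u = sigma u.
Proof.
move=> sb; apply: basis_ind => //; first by rewrite !linear0.
by move=> a u v hu hv; rewrite !linearP /= hu hv.
Qed.

(* A row eigenvector of the complexified matrix is a C-valued linear form l
   with l \o tau = z l; it cannot vanish on all the eigenvectors in s. *)
Lemma hyperbolic_of_eigenbasis tau s : basis_of fullv s ->
  {in s, forall u, exists2 c, tau u = c *: u & c ^+ 2 != 1} -> hyperbolic tau.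
Proof.
move=> sb H M z /eigenvalueP[v vM v0]; apply/eqP => z1; rewrite {}/M in vM.
set b := vbasis fullv in vM.
have bb : basis_of fullv b by exact: vbasisP.
pose l u := \sum_i v 0 i * ((coord b i u)%:C)%C.
have lD a u w : l (a *: u + w) = (a%:C)%C * l u + l w.
  rewrite mulr_sumr -big_split; apply: eq_bigr => i _ /=.
  by rewrite linearP rmorphD rmorphM /=; ring.
have l0 : l 0 = 0 by apply: big1 => i _; rewrite linear0 rmorph0 mulr0.
have lb j : l (tnth b j) = v 0 j.
  rewrite /l (bigD1 j) //= (tnth_nth 0) coord_free ?(basis_free bb) //.
  rewrite eqxx mulr1 big1 ?addr0 // => i ij.
  by rewrite coord_free ?(basis_free bb) // eq_sym (negPf ij) rmorph0 mulr0.
have ltau u : l (tau u) = z * l u.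
  apply: (basis_ind (P := fun u => l (tau u) = z * l u) bb) => [|a w w' hw hw'|w].
  - by rewrite linear0 l0 mulr0.
  - by rewrite linearP !lD hw hw'; ring.
  case/tnthP => j ->; rewrite lb.
  have := congr1 (fun w : 'rV_ _ => w 0 j) vM; rewrite !mxE => <-.
  by apply: eq_bigr => i _; rewrite !mxE.
have lz u : l u = 0.
  apply: (basis_ind (P := fun u => l u = 0) sb) => // [a w w' hw hw'|w ws].
    by rewrite lD hw hw' mulr0 addr0.
  have [c tw c1] := H w ws; apply/eqP; apply: contraNT c1 => lw.
  have E : z = (c%:C)%C.
    apply: (mulIf lw); rewrite -ltau tw -[c *: w]addr0 lD l0 addr0 //.
  move: z1; rewrite E normc_def /= expr0n addr0 sqrtr_sqr.
  move=> /(congr1 (@complex.Re R)) /= c1.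
  by rewrite -[c ^+ 2]real_normK ?num_real // c1 expr1n.
by case/eqP: v0; apply/rowP => j; rewrite mxE -lb lz.
Qed.

Section Lattice.
Variable b : (\dim {:V}).-tuple V.
Hypothesis bb : basis_of fullv b.

Definition Zlattice u := forall k, coord b k u \is a Num.int.

Lemma Zlattice_basis u : u \in b -> Zlattice u.
Proof.
by case/tnthP => i -> k; rewrite (tnth_nth 0) coord_free ?(basis_free bb).
Qed.

Lemma Zlattice_scale a u : a \is a Num.int -> Zlattice u -> Zlattice (a *: u).
Proof. by move=> ha hu k; rewrite linearZ; exact: (rpredM ha (hu k)). Qed.

Lemma Zlattice0 : Zlattice 0.
Proof. by move=> k; rewrite linear0. Qed.

Lemma Zlattice_sum n (F : 'I_n -> V) :
  (forall i, Zlattice (F i)) -> Zlattice (\sum_i F i).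
Proof. by move=> H k; rewrite linear_sum rpred_sum // => i _; exact: H. Qed.

Lemma mx_in_basis_comp tau sigma :
  mx_in_basis b (tau \o sigma)%VF = mx_in_basis b tau *m mx_in_basis b sigma.
Proof.
apply/matrixP => i j; rewrite !mxE comp_lfunE.
rewrite [X in tau X](coord_basis bb (memvf _)) !linear_sum.
by apply: eq_bigr => k _; rewrite !linearZ /= -tnth_nth !mxE mulrC.
Qed.

Lemma integral_mx tau : (forall u, u \in b -> Zlattice (tau u)) ->
  exists M : 'M[int]_(\dim {:V}), mx_in_basis b tau = map_mx intr M.
Proof.
(* [Num.floor] only moves entries that are already integers into the type [int]. *)
move=> H; exists (\matrix_(i, j) Num.floor (mx_in_basis b tau i j)).
by apply/matrixP => i j; rewrite !mxE floorK //; apply: H; exact: mem_tnth.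
Qed.

(** An inverse that also preserves the lattice supplies an integer inverse matrix, so no determinant
    has to be computed. *)
Lemma integral_unimodular_of_inverse tau sigma :
  (forall u, tau (sigma u) = u) ->
  (forall u, u \in b -> Zlattice (tau u)) ->
  (forall u, u \in b -> Zlattice (sigma u)) -> integral_unimodular b tau.
Proof.
move=> ts /integral_mx[M tM] /integral_mx[N sN]; exists M => //.
have MN : M *m N = 1%:M.
  have E : map_mx intr (M *m N) = map_mx intr 1%:M :> 'M[R]_(\dim {:V}).
    rewrite map_mxM -tM -sN -mx_in_basis_comp map_mx1.
    apply/matrixP => i j; rewrite !mxE comp_lfunE ts (tnth_nth 0).
    by rewrite coord_free ?(basis_free bb) // eq_sym.
  apply/matrixP => i j; apply: (@intr_inj R).
  by have := congr1 (fun A : 'M[R]_(\dim {:V}) => A i j) E; rewrite !mxE.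
by case: (mulmx1_unit MN).
Qed.

End Lattice.

(** The cast produces the tuple of length [\dim {:V}] over which [Zbasis] is stated; the count turns
    spanning into being a basis. *)
Lemma basis_of_span s : size s = \dim {:V} -> (fullv <= <<s>>)%VS ->
  exists b : (\dim {:V}).-tuple V, basis_of fullv b /\ b = s :> seq V.
Proof.
move=> ss sp; exists (tcast ss (in_tuple s)).
have E : tval (tcast ss (in_tuple s)) = s by rewrite val_tcast.
by split=> //; rewrite basisEdim E sp ss leqnn.
Qed.

End LinearAlgebra.

Lemma eq_remainder q i i' j k : (j < q)%N -> (k < q)%N ->
  (i * q + j = i' * q + k)%N -> j = k.
Proof.
by move=> jq kq /(congr1 (modn^~ q)); rewrite /= !modnMDl !modn_small.
Qed.

(** * The family X, Y, Z and its diagonal endomorphisms *)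

Section XYZFamily.
Variables (R : realType) (V : vectType R) (q : nat).
Implicit Types (X Y Z : nat -> V).

(** The index of X is split into a block i and a place j, matching the two tensor factors. The last
    two Z are set apart because they scale by y_i and not by a power of x_j. Places are counted from
    0, hence [j.+1]. *)
Variant XYZ_spec X Y Z : V -> Prop :=
| SpecX i j of (i < 2)%N & (j < q)%N : XYZ_spec X Y Z (X (i * q + j.+1)%N)
| SpecY j of (j < q)%N : XYZ_spec X Y Z (Y j.+1)
| SpecZ j of (j < q)%N : XYZ_spec X Y Z (Z j.+1)
| SpecW i of (i < 2)%N : XYZ_spec X Y Z (Z (q + i + 1)%N).

Lemma size_XYZ X Y Z : size (XYZ q X Y Z) = (4 * q + 2)%N.
Proof. by rewrite !size_cat !size_map !size_iota; lia. Qed.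

Lemma mem_XYZ_X X Y Z n : (0 < n <= 2 * q)%N -> X n \in XYZ q X Y Z.
Proof. by move=> h; rewrite !mem_cat map_f // mem_iota; lia. Qed.

Lemma mem_XYZ_Y X Y Z n : (0 < n <= q)%N -> Y n \in XYZ q X Y Z.
Proof.
move=> h; rewrite !mem_cat [Y n \in [seq Y _ | _ <- _]]map_f ?orbT //.
by rewrite mem_iota; lia.
Qed.

Lemma mem_XYZ_Z X Y Z n : (0 < n <= q + 2)%N -> Z n \in XYZ q X Y Z.
Proof.
move=> h; rewrite !mem_cat [Z n \in [seq Z _ | _ <- _]]map_f ?orbT //.
by rewrite mem_iota; lia.
Qed.

Lemma XYZP X Y Z u : u \in XYZ q X Y Z -> XYZ_spec X Y Z u.
Proof.
rewrite !mem_cat => /or3P[] /mapP[n]; rewrite mem_iota => hn ->{u}.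
- have [nq|qn] := leqP n q.
    have -> : n = (0 * q + n.-1.+1)%N by lia.
    by constructor; lia.
  have -> : n = (1 * q + (n - q.+1).+1)%N by lia.
  by constructor; lia.
- by have -> : n = n.-1.+1 by [lia]; constructor; lia.
- have [nq|qn] := leqP n q.
    by have -> : n = n.-1.+1 by [lia]; constructor; lia.
  have -> : n = (q + (n - q.+1) + 1)%N by lia.
  by constructor; lia.
Qed.

Lemma XYZ_specP X Y Z u : XYZ_spec X Y Z u -> u \in XYZ q X Y Z.
Proof.
case=> [i j i2 jq|j jq|j jq|i i2].
- by apply: mem_XYZ_X; nia.
- by apply: mem_XYZ_Y; lia.
- by apply: mem_XYZ_Z; lia.
- by apply: mem_XYZ_Z; lia.
Qed.

Lemma nth_XYZ_X X Y Z n : (0 < n <= 2 * q)%N -> (XYZ q X Y Z)`_(n.-1) = X n.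
Proof.
move=> h; rewrite nth_cat size_map size_iota ifT; last by lia.
by rewrite (nth_map 0%N) ?size_iota ?nth_iota; try lia; congr X; lia.
Qed.

Lemma nth_XYZ_Y X Y Z n : (0 < n <= q)%N -> (XYZ q X Y Z)`_(2 * q + n.-1) = Y n.
Proof.
move=> h; rewrite nth_cat size_map size_iota ifF; last by lia.
rewrite nth_cat size_map size_iota ifT; last by lia.
by rewrite (nth_map 0%N) ?size_iota ?nth_iota; try lia; congr Y; lia.
Qed.

Lemma nth_XYZ_Z X Y Z n :
  (0 < n <= q + 2)%N -> (XYZ q X Y Z)`_(3 * q + n.-1) = Z n.
Proof.
move=> h; rewrite nth_cat size_map size_iota ifF; last by lia.
rewrite nth_cat size_map size_iota ifF; last by lia.
by rewrite (nth_map 0%N) ?size_iota ?nth_iota; try lia; congr Z; lia.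
Qed.

Lemma diagonal_exists X Y Z (cX cY cZ : nat -> R) : free (XYZ q X Y Z) ->
  exists tau : 'End(V),
    [/\ forall n, (0 < n <= 2 * q)%N -> tau (X n) = cX n *: X n,
        forall n, (0 < n <= q)%N -> tau (Y n) = cY n *: Y n
      & forall n, (0 < n <= q + 2)%N -> tau (Z n) = cZ n *: Z n].
Proof.
move=> fr.
pose fs := XYZ q (fun n => cX n *: X n) (fun n => cY n *: Y n)
  (fun n => cZ n *: Z n).
have [f fE] := linear_of_free (XYZ q X Y Z) fs.
have {}fE : [seq f i | i <- XYZ q X Y Z] = fs by apply: fE; rewrite ?size_XYZ.
have nthE k : (k < 4 * q + 2)%N -> f (XYZ q X Y Z)`_k = fs`_k.
  by move=> hk; rewrite -fE (nth_map 0) // size_XYZ.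
exists (linfun f); split=> n hn; rewrite lfunE /=.
- by rewrite -(nth_XYZ_X X Y Z hn) nthE; [rewrite nth_XYZ_X // nth_XYZ_X|lia].
- by rewrite -(nth_XYZ_Y X Y Z hn) nthE; [rewrite nth_XYZ_Y // nth_XYZ_Y|lia].
- by rewrite -(nth_XYZ_Z X Y Z hn) nthE; [rewrite nth_XYZ_Z // nth_XYZ_Z|lia].
Qed.

End XYZFamily.

(** * Bracket table, nilpotency and type *)

Section Presented.
Variables (R : realType) (q : nat) (V : vectType R).
Variables (br : {bilinear V -> V -> V}) (X Y Z : nat -> V).
Hypotheses (q2 : (2 <= q)%N) (brA : alternating br).
Hypothesis brP : presented q br X Y Z.

Let s := XYZ q X Y Z.
Let sb : basis_of fullv s := presented_basis brP.

Lemma bracket_antisym u v : br u v = - br v u.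
Proof.
have := brA (u + v); rewrite linearDl !linearDr !brA add0r addr0.
by move/eqP; rewrite addr_eq0 => /eqP.
Qed.

(** [listed] speaks of vectors, not of indices. Freeness excludes repetitions, so a basis vector
    determines its kind and its index, which is what the next lemmas extract. *)
Lemma nth_basis_inj i j : (i < 4 * q + 2)%N -> (j < 4 * q + 2)%N ->
  s`_i = s`_j -> i = j.
Proof.
move=> hi hj /eqP; rewrite nth_uniq ?size_XYZ // ?(free_uniq (basis_free sb)) //.
by move/eqP.
Qed.

Lemma X_inj m n : (0 < m <= 2 * q)%N -> (0 < n <= 2 * q)%N -> X m = X n -> m = n.
Proof.
move=> hm hn; rewrite -(nth_XYZ_X X Y Z hm) -(nth_XYZ_X X Y Z hn).
by move/nth_basis_inj => E; lia.
Qed.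

Lemma Y_inj m n : (0 < m <= q)%N -> (0 < n <= q)%N -> Y m = Y n -> m = n.
Proof.
move=> hm hn; rewrite -(nth_XYZ_Y X Y Z hm) -(nth_XYZ_Y X Y Z hn).
by move/nth_basis_inj => E; lia.
Qed.

Lemma X_neq_Y m n : (0 < m <= 2 * q)%N -> (0 < n <= q)%N -> X m <> Y n.
Proof.
move=> hm hn; rewrite -(nth_XYZ_X X Y Z hm) -(nth_XYZ_Y X Y Z hn).
by move/nth_basis_inj => E; lia.
Qed.

Lemma X_neq_Z m n : (0 < m <= 2 * q)%N -> (0 < n <= q + 2)%N -> X m <> Z n.
Proof.
move=> hm hn; rewrite -(nth_XYZ_X X Y Z hm) -(nth_XYZ_Z X Y Z hn).
by move/nth_basis_inj => E; lia.
Qed.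

Lemma Y_neq_Z m n : (0 < m <= q)%N -> (0 < n <= q + 2)%N -> Y m <> Z n.
Proof.
move=> hm hn; rewrite -(nth_XYZ_Y X Y Z hm) -(nth_XYZ_Z X Y Z hn).
by move/nth_basis_inj => E; lia.
Qed.

Lemma bracket_cases u v : u \in s -> v \in s ->
  br u v = 0 \/ exists w, listed q X Y Z u v w \/ listed q X Y Z v u w.
Proof.
move=> us vs; have [->|/eqP ne] := eqVneq (br u v) 0; first by left.
by right; exact: (presented_only brP).
Qed.

(** A nonzero bracket would have to be listed in some order; for j != k every such listing
    contradicts the distinctness of the basis vectors. *)
Lemma bracket_XY i j k : (i < 2)%N -> (j < q)%N -> (k < q)%N ->
  br (X (i * q + j.+1)%N) (Y k.+1) = if j == k then Z (q + i + 1)%N else 0.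
Proof.
move=> i2 jq kq; case: eqP => [<-|ne].
  by apply: (presented_bracket brP); left; exists i, j.+1; split=> //; lia.
have Xs : X (i * q + j.+1)%N \in s by apply: mem_XYZ_X; nia.
have Ys : Y k.+1 \in s by apply: mem_XYZ_Y; lia.
have [//|[w [[[i' [j' [i'2 j'q [E1 E2 _]]]]|[j' j'q [_ E _]]]|]]] :=
  bracket_cases Xs Ys.
- have e1 : (i * q + j.+1 = i' * q + j')%N by apply: X_inj E1; nia.
  have e2 : k.+1 = j' by apply: Y_inj E2; lia.
  by case: ne; apply: (@eq_remainder q i i'); lia.
- by case: (@X_neq_Y (j' + q) k.+1); rewrite ?E //; lia.
case=> [[i' [j' [i'2 j'q [E _ _]]]]|[j' j'q [E _ _]]].
- by case: (@X_neq_Y (i' * q + j') k.+1); rewrite ?E //; nia.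
- by case: (@X_neq_Y j' k.+1); rewrite ?E //; lia.
Qed.

(** The coefficient i' - i is the wedge of the basis vectors e_i and e_i' of the plane, covering the
    values 0, 1 and -1 in one formula. *)
Lemma bracket_XX i i' j k : (i < 2)%N -> (i' < 2)%N -> (j < q)%N -> (k < q)%N ->
  br (X (i * q + j.+1)%N) (X (i' * q + k.+1)%N) =
  if j == k then (i'%:R - i%:R) *: Z j.+1 else 0.
Proof.
move=> i2 i'2 jq kq.
have list j1 : (j1 < q)%N -> br (X j1.+1) (X (q + j1.+1)%N) = Z j1.+1.
  move=> h; apply: (presented_bracket brP); right; exists j1.+1 => //.
  by rewrite addnC.
have inX a b : (a < 2)%N -> (b < q)%N -> X (a * q + b.+1)%N \in s.
  by move=> h1 h2; apply: mem_XYZ_X; nia.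
case: eqP => [<-|ne].
  case: i i' i2 i'2 => [|[|i]] [|[|i']] // _ _; rewrite ?mul0n ?mul1n ?add0n.
  - by rewrite brA subrr scale0r.
  - by rewrite list // subr0 scale1r.
  - by rewrite bracket_antisym list // sub0r scaleN1r.
  - by rewrite brA subrr scale0r.
have no i1 i1' j1 k1 w : (i1 < 2)%N -> (i1' < 2)%N -> (j1 < q)%N -> (k1 < q)%N ->
    j1 <> k1 -> ~ listed q X Y Z (X (i1 * q + j1.+1)%N) (X (i1' * q + k1.+1)%N) w.
  move=> h1 h2 h3 h4 h5 [[a [b [a2 bq [_ E _]]]]|[b bq [E1 E2 _]]].
    by move/X_neq_Y: E; apply; nia.
  have e1 : (i1 * q + j1.+1 = b)%N by apply: X_inj E1; nia.
  have e2 : (i1' * q + k1.+1 = b + q)%N by apply: X_inj E2; nia.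
  (* The shift by q between the two listed indices is absorbed into the block number, which becomes
     [i1.+1]. *)
  by apply: h5; apply: (@eq_remainder q i1.+1 i1'); lia.
have [//|[w [|]]] := bracket_cases (inX _ _ i2 jq) (inX _ _ i'2 kq).
  by move/no; case.
by move/no; case=> // E; exact: ne.
Qed.

Lemma bracket_YY j k : (j < q)%N -> (k < q)%N -> br (Y j.+1) (Y k.+1) = 0.
Proof.
have no j1 v w : (j1 < q)%N -> ~ listed q X Y Z (Y j1.+1) v w.
  move=> h [[i' [j' [i'2 j'q [/esym E _ _]]]]|[j' j'q [/esym E _ _]]];
    by move/X_neq_Y: E; apply; nia.
move=> jq kq; have Ys k1 : (k1 < q)%N -> Y k1.+1 \in s.
  by move=> h; apply: mem_XYZ_Y; lia.
by have [//|[w [/no|/no]]] := bracket_cases (Ys _ jq) (Ys _ kq); case.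
Qed.

(** This span is shown to be annihilated by all brackets and to equal the derived algebra, which
    yields step two. *)
Let C := <<[seq Z l | l <- iota 1 (q + 2)]>>%VS.

Lemma bracket_Z u n : (0 < n <= q + 2)%N -> br u (Z n) = 0.
Proof.
move=> hn; move: u; apply: (basis_ind sb); first exact: linear0l.
  by move=> a u v hu hv; rewrite linearDl linearZl_LR hu hv /= scaler0 addr0.
move=> u us; have Zs : Z n \in s by exact: mem_XYZ_Z.
have [//|[w [[[i' [j' [i'2 j'q [_ E _]]]]|[j' j'q [_ E _]]]|]]] :=
  bracket_cases us Zs.
- by move/esym/Y_neq_Z: E; case.
- by move/esym/X_neq_Z: E; case=> //; lia.
case=> [[i' [j' [i'2 j'q [E _ _]]]]|[j' j'q [E _ _]]].
- by move/esym/X_neq_Z: E; case=> //; nia.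
- by move/esym/X_neq_Z: E; case=> //; lia.
Qed.

Lemma center_Z n : (0 < n <= q + 2)%N -> Z n \in C.
Proof. by move=> hn; apply/memv_span/map_f; rewrite mem_iota; lia. Qed.

Lemma bracket_center u z : z \in C -> br u z = 0.
Proof.
apply: (span_ind (P := fun z => br u z = 0)); first exact: linear0r.
  by move=> a v w hv hw; rewrite linearDr linearZr_LR hv hw /= scaler0 addr0.
by move=> _ /mapP[n + ->]; rewrite mem_iota => hn; apply: bracket_Z; lia.
Qed.

Lemma bracket_in_center u v : br u v \in C.
Proof.
move: u v; apply: (bilinear_in sb) => u v us vs.
have inC u' v' w : listed q X Y Z u' v' w -> br u' v' \in C.
  move=> L; rewrite (presented_bracket brP L).
  case: L => [[i [j [i2 jq [_ _ ->]]]]|[j jq [_ _ ->]]]; apply: center_Z; lia.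
have [->|[w [/inC //|/inC]]] := bracket_cases us vs; first exact: mem0v.
by rewrite bracket_antisym rpredN.
Qed.

(** Brackets land in [C], which brackets to zero with everything, so each term of the Jacobi sum
    vanishes. *)
Lemma lie_bracket_presented : lie_bracket br.
Proof.
have E a b c : br a (br b c) = 0 by apply/bracket_center/bracket_in_center.
by split=> // u v w; rewrite !E !addr0.
Qed.

Lemma lcs1 : lcs br 1 = C.
Proof.
apply/eqP; rewrite eqEsubv; apply/andP; split.
  by apply: brv_sub => u w _ _; exact: bracket_in_center.
apply/span_subvP => _ /mapP[n + ->]; rewrite mem_iota => hn.
suff [u [v <-]] : exists u v, br u v = Z n by apply: memv_brv; exact: memvf.
(* Each Z_n is a single bracket: [X_n, X_(n+q)] for n <= q, and [X_(iq+1), Y_1] with i = n - q - 1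
   otherwise. *)
have [nq|qn] := leqP n q.
  exists (X (0 * q + n.-1.+1)%N), (X (1 * q + n.-1.+1)%N).
  rewrite bracket_XX ?eqxx ?subr0 ?scale1r; try lia.
  by congr Z; lia.
exists (X ((n - q.+1) * q + 1)%N), (Y 1%N).
by rewrite bracket_XY ?eqxx; try lia; congr Z; lia.
Qed.

Lemma lcs2 : lcs br 2 = 0%VS.
Proof.
apply/eqP; rewrite -subv0 -[lcs br 2]/(brv br fullv (lcs br 1)) lcs1.
by apply: brv_sub => u w _ wC; rewrite bracket_center // mem0v.
Qed.

Lemma dim_center : \dim C = (q + 2)%N.
Proof.
have /catr_free/catr_free := basis_free sb.
by rewrite /free => /eqP ->; rewrite size_map size_iota.
Qed.

Lemma dim_presented : \dim {:V} = (4 * q + 2)%N.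
Proof. by rewrite -(size_XYZ q X Y Z) (size_basis (X := in_tuple s) sb). Qed.

Lemma nilpotent_presented : nilpotent_of_step br 2.
Proof.
split=> //; split; first exact: lcs2.
by rewrite lcs1 => C0; have := dim_center; rewrite C0 dimv0; lia.
Qed.

Lemma type_presented : of_type br [:: 3 * q; q + 2]%N.
Proof.
split; first exact: nilpotent_presented.
have d0 : \dim (lcs br 0 :\: lcs br 1) = (3 * q)%N.
  have := dimv_cap_compl (lcs br 0) (lcs br 1).
  by rewrite lcs1 capfv dim_center dim_presented; lia.
have d1 : \dim (lcs br 1 :\: lcs br 2) = (q + 2)%N.
  have := dimv_cap_compl (lcs br 1) (lcs br 2).
  by rewrite lcs1 lcs2 capv0 dimv0 dim_center.
by congr [:: _; _]; [rewrite -d0|rewrite -d1].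
Qed.

End Presented.

(** * Combinations weighted by values at the roots *)

Section Combinations.
Variables (R : realType) (V : vectType R).
Implicit Types (h c : nat -> R) (F : nat -> V).

Definition comb n h F := \sum_(j < n) h j *: F j.

Lemma eq_comb n h h' F F' : (forall j, (j < n)%N -> h j *: F j = h' j *: F' j) ->
  comb n h F = comb n h' F'.
Proof. by move=> E; apply: eq_bigr => j _; exact: E. Qed.

Lemma comb_delta n h j u : (j < n)%N ->
  comb n h (fun k => if j == k then u else 0) = h j *: u.
Proof.
move=> jn; rewrite /comb (bigD1 (Ordinal jn)) //= eqxx big1 ?addr0 // => k.
by rewrite -val_eqE eq_sym /= => /negPf ->; rewrite scaler0.
Qed.

Lemma comb_swap m n g h (F : nat -> nat -> V) :
  comb m g (fun i => comb n h (fun j => F i j)) =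
  comb n h (fun j => comb m g (fun i => F i j)).
Proof.
rewrite /comb; under eq_bigr => i _ do rewrite scaler_sumr.
rewrite exchange_big; apply: eq_bigr => j _; rewrite scaler_sumr.
by apply: eq_bigr => i _; rewrite !scalerA mulrC.
Qed.

Lemma comb_scaler n h a F : comb n h (fun j => a *: F j) = a *: comb n h F.
Proof. by rewrite scaler_sumr; apply: eq_bigr => j _; rewrite !scalerA mulrC. Qed.

Lemma comb2 k F : comb 2 k F = k 0%N *: F 0%N + k 1%N *: F 1%N.
Proof. by rewrite /comb !big_ord_recl big_ord0 addr0. Qed.

Lemma linear_comb (tau : 'End(V)) n h F :
  tau (comb n h F) = comb n h (fun j => tau (F j)).
Proof. by rewrite linear_sum; apply: eq_bigr => j _; rewrite linearZ. Qed.

Lemma bilinear_combl (br : {bilinear V -> V -> V}) n h F v :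
  br (comb n h F) v = comb n h (fun j => br (F j) v).
Proof. by rewrite linear_sumlz; apply: eq_bigr => j _; rewrite linearZl_LR. Qed.

Lemma bilinear_combr (br : {bilinear V -> V -> V}) n h F v :
  br v (comb n h F) = comb n h (fun j => br v (F j)).
Proof. by rewrite linear_sumr; apply: eq_bigr => j _; rewrite linearZr_LR. Qed.

Lemma comb_expand n x h c F :
  (forall j, (j < n)%N -> h j = \sum_(k < n) c k * x j ^+ k) ->
  comb n h F = \sum_(k < n) c k *: comb n (fun j => x j ^+ k) F.
Proof.
move=> hE; under [RHS]eq_bigr => k _ do rewrite scaler_sumr.
rewrite exchange_big; apply: eq_bigr => j _ /=; rewrite hE // scaler_suml.
by apply: eq_bigr => k _; rewrite scalerA.
Qed.

(** Reduction modulo f writes h as an integer combination of powers below n, so those powers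
    suffice. *)
Lemma comb_lattice (b : (\dim {:V}).-tuple V) n x f h F :
  unit_roots n x f -> Zfun n x h ->
  (forall k, (k < n)%N -> Zlattice b (comb n (fun j => x j ^+ k) F)) ->
  Zlattice b (comb n h F).
Proof.
move=> xf /(Zfun_reduce xf)[c hE] H.
rewrite (comb_expand (c := fun k => (c k)%:~R) F hE).
by apply: Zlattice_sum => k; apply: Zlattice_scale; [exact: intr_int|exact: H].
Qed.

(** Inverting the Vandermonde matrix recovers each [F j] from the combinations weighted by
    powers. *)
Lemma comb_span (S : {vspace V}) n x f F : unit_roots n x f ->
  (forall k, (k < n)%N -> comb n (fun j => x j ^+ k) F \in S) ->
  forall j, (j < n)%N -> F j \in S.
Proof.
move=> xf H j jn; have [U [xU _]] := Vandermonde_inverse xf.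
have -> : F j = comb n (fun i => (i == j)%:R) F.
  rewrite -[F j]scale1r -[1]/(true%:R) -(eqxx j).
  rewrite -(comb_delta (fun i => (i == j)%:R) (F j) jn).
  by apply: eq_comb => i _; case: (eqVneq i j) => [->|_]; rewrite ?eqxx // !scale0r.
rewrite (@comb_expand n x _ (U^~ j)) => [|i ilt].
  by apply: rpred_sum => k _; rewrite rpredZ // H.
by rewrite -xU //; apply: eq_bigr => k _; rewrite mulrC.
Qed.

End Combinations.

(** * The invariant lattice *)

Section Lattice.
Variables (R : realType) (q : nat) (V : vectType R).
Variables (br : {bilinear V -> V -> V}) (X Y Z : nat -> V).
Hypotheses (q2 : (2 <= q)%N) (brA : alternating br).
Hypothesis brP : presented q br X Y Z.
Variables (x y : nat -> R) (f g : {poly int}).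
Hypotheses (xf : unit_roots q x f) (yg : unit_roots 2 y g).
Hypothesis y01 : y 0%N * y 1%N = 1.
Hypothesis x2_neq1 : forall j, (j < q)%N -> x j ^+ 2 != 1.
Hypothesis y2_neq1 : forall i, (i < 2)%N -> y i ^+ 2 != 1.
Hypothesis xy_neq : forall i j, (i < 2)%N -> (j < q)%N -> y i ^+ 2 != x j ^+ 2.

Let sb : basis_of fullv (XYZ q X Y Z) := presented_basis brP.

(** This is a pure tensor: [h] holds the values of an element of K at the x_j, and [k] the values at
    y_0, y_1 of a polynomial in y. *)
Definition Xcomb (k h : nat -> R) :=
  comb 2 k (fun i => comb q h (fun j => X (i * q + j.+1)%N)).
Definition Ycomb (h : nat -> R) := comb q h (fun j => Y j.+1).
(* The factor y_1 - y_0 divides k_0 k'_1 - k_1 k'_0 for integral k and k', the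
   quotient being an integer. *)
Definition Zcomb (h : nat -> R) := comb q h (fun j => (y 1%N - y 0%N) *: Z j.+1).
Definition Wcomb (k : nat -> R) := comb 2 k (fun i => Z (q + i + 1)%N).

(** The scalar is the trace form Tr(h h'). *)
Lemma bracket_Xcomb_Ycomb k h h' :
  br (Xcomb k h) (Ycomb h') = (\sum_(j < q) h j * h' j) *: Wcomb k.
Proof.
rewrite /Xcomb bilinear_combl -comb_scaler; apply: eq_bigr => i _.
rewrite bilinear_combl scaler_suml; congr (_ *: _); apply: eq_bigr => j _.
rewrite /Ycomb bilinear_combr -scalerA -(comb_delta h' _ (ltn_ord j)).
by congr (_ *: _); apply: eq_comb => l lq; rewrite (bracket_XY q2 brP).
Qed.

(** The scalar is the wedge of [k] and [k'], while [h] and [h'] multiply as elements of K. *)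
Lemma bracket_Xcomb_Xcomb k h k' h' :
  br (Xcomb k h) (Xcomb k' h') = (k 0%N * k' 1%N - k 1%N * k' 0%N) *:
    comb q (fun j => h j * h' j) (fun j => Z j.+1).
Proof.
have E i i' : (i < 2)%N -> (i' < 2)%N ->
    br (comb q h (fun j => X (i * q + j.+1)%N))
       (comb q h' (fun j => X (i' * q + j.+1)%N)) =
    (i'%:R - i%:R) *: comb q (fun j => h j * h' j) (fun j => Z j.+1).
  move=> i2 i'2; rewrite bilinear_combl -comb_scaler; apply: eq_bigr => j _.
  rewrite bilinear_combr -scalerA -(comb_delta h' _ (ltn_ord j)).
  by congr (_ *: _); apply: eq_comb => l lq; rewrite (bracket_XX q2 brA brP).
rewrite /Xcomb !comb2 !linearDl !linearDr !linearZl_LR !linearZr_LR /= !E //.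
by rewrite !scalerA -!scalerDl; congr (_ *: _); ring.
Qed.

Lemma bracket_Ycomb_Ycomb h h' : br (Ycomb h) (Ycomb h') = 0.
Proof.
rewrite /Ycomb bilinear_combl [LHS]big1 // => j _.
rewrite bilinear_combr [X in _ *: X]big1 ?scaler0 // => l _.
by rewrite (bracket_YY q2 brP) // scaler0.
Qed.

Lemma bracket_Zcomb u h : br u (Zcomb h) = 0.
Proof.
rewrite /Zcomb bilinear_combr [LHS]big1 // => j _.
by rewrite linearZr_LR (bracket_Z q2 brP) /= ?scaler0 //; have := ltn_ord j; lia.
Qed.

Lemma bracket_Wcomb u k : br u (Wcomb k) = 0.
Proof.
rewrite /Wcomb bilinear_combr [LHS]big1 // => i _.
by rewrite (bracket_Z q2 brP) ?scaler0 //; have := ltn_ord i; lia.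
Qed.

(** Arbitrary integer polynomials replace the powers in the lattice basis. Unlike that basis, this
    class is stable under multiplication by x and y, so reduction modulo f and g is done only once,
    in [integral_comb_lattice]. *)
Variant integral_comb : V -> Prop :=
| IntegralX k h of Zfun 2 y k & Zfun q x h : integral_comb (Xcomb k h)
| IntegralY h of Zfun q x h : integral_comb (Ycomb h)
| IntegralZ h of Zfun q x h : integral_comb (Zcomb h)
| IntegralW k of Zfun 2 y k : integral_comb (Wcomb k).

(** The lattice basis is numbered like [XYZ]: dividing n - 1 by q recovers the exponents of y and x,
    and the last two Z carry the exponents 0 and 1 of y. *)
Let X' n := Xcomb (fun i => y i ^+ (n.-1 %/ q)) (fun j => x j ^+ (n.-1 %% q)).
Let Y' n := Ycomb (fun j => x j ^+ n.-1).
Let Z' n := if (n <= q)%N then Zcomb (fun j => x j ^+ n.-1)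
            else Wcomb (fun i => y i ^+ (n - q.+1)).
Let s' := XYZ q X' Y' Z'.

Let X'E i j : (j < q)%N ->
  X' (i * q + j.+1)%N = Xcomb (fun l => y l ^+ i) (fun l => x l ^+ j).
Proof.
move=> jq; rewrite /X' addnS /= divnMDl; last by lia.
by rewrite divn_small // addn0 modnMDl modn_small.
Qed.

Let Z'E j : (j < q)%N -> Z' j.+1 = Zcomb (fun l => x l ^+ j).
Proof. by move=> jq; rewrite /Z' jq. Qed.

Let W'E i : Z' (q + i + 1)%N = Wcomb (fun l => y l ^+ i).
Proof. by rewrite /Z' ifF; [congr Wcomb; rewrite addn1 subSS addKn|lia]. Qed.

Lemma integral_basis_comb u : u \in s' -> integral_comb u.
Proof.
case/XYZP => [i j i2 jq|j jq|j jq|i i2].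
- by rewrite X'E //; constructor; exact: Zfun_exp.
- by constructor; exact: Zfun_exp.
- by rewrite Z'E //; constructor; exact: Zfun_exp.
- by rewrite W'E; constructor; exact: Zfun_exp.
Qed.

Let y_neq : y 1%N - y 0%N != 0.
Proof.
case: yg => _ _ _ yI _; rewrite subr_eq0; apply/eqP => E.
by have := yI 1%N 0%N isT isT E.
Qed.

Lemma integral_basis_span : (fullv <= <<s'>>)%VS.
Proof.
have s'X i j : (i < 2)%N -> (j < q)%N ->
    Xcomb (fun l => y l ^+ i) (fun l => x l ^+ j) \in <<s'>>%VS.
  by move=> i2 jq; apply: memv_span; rewrite -X'E //; apply: XYZ_specP; constructor.
rewrite -(span_basis sb); apply/span_subvP => _ /XYZP[i j i2 jq|j jq|j jq|i i2].
(* Two Vandermonde inversions are needed, one for each tensor factor. *)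
- apply: (comb_span (F := fun j => X (i * q + j.+1)%N) xf) => // l lq.
  apply: (comb_span (F := fun i => comb q (fun j => x j ^+ l)
    (fun j => X (i * q + j.+1)%N)) yg) => // k k2; exact: s'X.
- apply: (comb_span (F := fun j => Y j.+1) xf) => // l lq.
  by apply: memv_span; apply: (XYZ_specP (SpecY _ _ _ lq)).
(* Over R the factor y_1 - y_0 built into [Zcomb] can be divided out. *)
- rewrite -[Z _](scalerK y_neq) rpredZ //.
  apply: (comb_span (F := fun j => (y 1%N - y 0%N) *: Z j.+1) xf) => // l lq.
  by apply: memv_span; rewrite -/(Zcomb _) -Z'E //; apply: XYZ_specP; constructor.
- apply: (comb_span (F := fun i => Z (q + i + 1)%N) yg) => // l l2.
  by apply: memv_span; rewrite -/(Wcomb _) -W'E; apply: XYZ_specP; constructor.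
Qed.

(** * Integrality of the structure constants *)

Section Frame.
Variable b : (\dim {:V}).-tuple V.
Hypotheses (bb : basis_of fullv b) (bs' : b = s' :> seq V).

Lemma integral_comb_lattice u : integral_comb u -> Zlattice b u.
Proof.
have inb v : v \in s' -> Zlattice b v.
  by move=> vs; apply: (Zlattice_basis bb); rewrite -[_ \in _]/(v \in tval b) bs'.
case=> [k h hk hh|h hh|h hh|k hk].
(* Reducing [h] requires its sum to be outermost; the second swap restores the shape of a basis
   vector. *)
- apply: (comb_lattice yg hk) => a a2; rewrite comb_swap.
  apply: (comb_lattice xf hh) => m mq; rewrite comb_swap.
  by apply: inb; rewrite -/(Xcomb _ _) -X'E //; apply: XYZ_specP; constructor.
- apply: (comb_lattice xf hh) => m mq.
  by apply: inb; apply: (XYZ_specP (SpecY _ _ _ mq)).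
- apply: (comb_lattice xf hh) => m mq.
  by apply: inb; rewrite -/(Zcomb _) -Z'E //; apply: XYZ_specP; constructor.
- apply: (comb_lattice yg hk) => a a2.
  by apply: inb; rewrite -/(Wcomb _) -W'E; apply: XYZ_specP; constructor.
Qed.

Lemma integral_bracket_lattice u v :
  integral_comb u -> integral_comb v -> Zlattice b (br u v).
Proof.
have antisym := bracket_antisym brA.
have XY k h h' : Zfun 2 y k -> Zfun q x h -> Zfun q x h' ->
    Zlattice b (br (Xcomb k h) (Ycomb h')).
  move=> hk hh hh'; rewrite bracket_Xcomb_Ycomb; apply: Zlattice_scale.
    exact: (Zfun_sum xf (Zfun_mul hh hh')).
  by apply: integral_comb_lattice; constructor.
have N w : Zlattice b w -> Zlattice b (- w).
  by move=> hw; rewrite -scaleN1r; apply: Zlattice_scale; rewrite // rpredN rpred1.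
have lZ : Zlattice b 0 by exact: Zlattice0.
(* Of the sixteen cases all but X against X vanish or follow from [XY] and antisymmetry. *)
case=> [k h hk hh|h hh|h hh|k hk]; case=> [k' h' hk' hh'|h' hh'|h' hh'|k' hk'];
  rewrite ?bracket_Zcomb ?bracket_Wcomb ?bracket_Ycomb_Ycomb //; try exact: XY;
  try by rewrite antisym ?bracket_Zcomb ?bracket_Wcomb ?oppr0 //; apply/N/XY.
rewrite bracket_Xcomb_Xcomb.
have [c kE] := Zfun_reduce yg hk; have [c' k'E] := Zfun_reduce yg hk'.
(* With k_i = c_0 + c_1 y_i and k'_i = c'_0 + c'_1 y_i, the wedge is an integer times y_1 - y_0, and
   the latter factor is absorbed by [Zcomb]. *)
have -> : k 0%N * k' 1%N - k 1%N * k' 0%N =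
    (c 0%N * c' 1%N - c 1%N * c' 0%N)%:~R * (y 1%N - y 0%N).
  rewrite !kE ?k'E // !big_ord_recl !big_ord0 /= !rmorphB !rmorphM /=; ring.
rewrite -scalerA -comb_scaler; apply: Zlattice_scale; first exact: intr_int.
by apply: integral_comb_lattice; constructor; exact: Zfun_mul.
Qed.

Lemma integral_basis_Zbasis : Zbasis br b.
Proof.
split=> // i j k; apply: integral_bracket_lattice; apply: integral_basis_comb;
  by rewrite -bs'; exact: mem_tnth.
Qed.

End Frame.

(** * The diagonal automorphism and its inverse *)

Let x0 j : (j < q)%N -> x j != 0. Proof. exact: (unit_roots_neq0 xf). Qed.
Let y0 i : (i < 2)%N -> y i != 0. Proof. exact: (unit_roots_neq0 yg). Qed.

Definition scaling tau (a : nat -> nat -> R) (c d e : nat -> R) :=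
  [/\ forall i j, (i < 2)%N -> (j < q)%N ->
        tau (X (i * q + j.+1)%N) = a i j *: X (i * q + j.+1)%N,
      forall j, (j < q)%N -> tau (Y j.+1) = c j *: Y j.+1,
      forall j, (j < q)%N -> tau (Z j.+1) = d j *: Z j.+1
    & forall i, (i < 2)%N -> tau (Z (q + i + 1)%N) = e i *: Z (q + i + 1)%N].

Lemma scaling_exists a c d e : exists tau : 'End(V), scaling tau a c d e.
Proof.
have [tau [tX tY tZ]] := diagonal_exists
  (fun n => a (n.-1 %/ q) (n.-1 %% q))%N (fun n => c n.-1)
  (fun n => if (n <= q)%N then d n.-1 else e (n - q.+1)%N) (basis_free sb).
exists tau; split=> [i j i2 jq|j jq|j jq|i i2].
- rewrite tX; last by nia.
  rewrite addnS /= divnMDl; last by lia.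
  by rewrite divn_small // addn0 modnMDl modn_small.
- by rewrite tY.
- by rewrite tZ ?jq //; lia.
- rewrite tZ; last by lia.
  by rewrite ifF; [congr (e _ *: _); lia|lia].
Qed.

(** Scaling by the values of an integer polynomial is multiplication in Z[t]/(f) or Z[t]/(g). On the
    X-part the eigenvalues are required to be products [k i * h j], so that pure tensors go to pure
    tensors. *)
Lemma integral_comb_scaling (tau : 'End(V)) k h c d e :
  scaling tau (fun i j => k i * h j) c d e ->
  Zfun 2 y k -> Zfun q x h -> Zfun q x c -> Zfun q x d -> Zfun 2 y e ->
  forall u, integral_comb u -> integral_comb (tau u).
Proof.
move=> [tX tY tZ tW] zk zh zc zd ze _ [k' h' hk hh|h' hh|h' hh|k' hk].
- have -> : tau (Xcomb k' h') = Xcomb (fun i => k' i * k i) (fun j => h' j * h j).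
    rewrite linear_comb; apply: eq_comb => i i2.
    rewrite linear_comb -scalerA; congr (_ *: _).
    rewrite -comb_scaler; apply: eq_comb => j jq.
    by rewrite tX // !scalerA; congr (_ *: _); ring.
  by constructor; exact: Zfun_mul.
- have -> : tau (Ycomb h') = Ycomb (fun j => h' j * c j).
    by rewrite linear_comb; apply: eq_comb => j jq; rewrite tY // scalerA.
  by constructor; exact: Zfun_mul.
- have -> : tau (Zcomb h') = Zcomb (fun j => h' j * d j).
    rewrite linear_comb; apply: eq_comb => j jq.
    by rewrite linearZ /= tZ // !scalerA; congr (_ *: _); ring.
  by constructor; exact: Zfun_mul.
- have -> : tau (Wcomb k') = Wcomb (fun i => k' i * e i).
    by rewrite linear_comb; apply: eq_comb => i i2; rewrite tW // scalerA.
  by constructor; exact: Zfun_mul.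
Qed.

Lemma scaling_comp_id (tau sigma : 'End(V)) a c d e :
  scaling tau a c d e ->
  scaling sigma (fun i j => (a i j)^-1) (fun j => (c j)^-1) (fun j => (d j)^-1)
    (fun i => (e i)^-1) ->
  (forall i j, (i < 2)%N -> (j < q)%N -> a i j != 0) ->
  (forall j, (j < q)%N -> c j != 0) -> (forall j, (j < q)%N -> d j != 0) ->
  (forall i, (i < 2)%N -> e i != 0) -> forall u, tau (sigma u) = u.
Proof.
move=> [tX tY tZ tW] [sX sY sZ sW] a0 c0 d0 e0 u.
rewrite -comp_lfunE -[RHS]id_lfunE; apply: (eq_on_basis sb) => _
  /XYZP[i j i2 jq|j jq|j jq|i i2]; rewrite comp_lfunE id_lfunE.
- by rewrite sX // linearZ /= tX // scalerA mulVf ?scale1r ?a0.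
- by rewrite sY // linearZ /= tY // scalerA mulVf ?scale1r ?c0.
- by rewrite sZ // linearZ /= tZ // scalerA mulVf ?scale1r ?d0.
- by rewrite sW // linearZ /= tW // scalerA mulVf ?scale1r ?e0.
Qed.

(** Eigenvalues multiply correctly on the listed pairs: (y_i / x_j) x_j = y_i, and (y_0 / x_j) (y_1
    / x_j) = x_j^-2 because y_0 y_1 = 1. On other pairs of basis vectors both sides are zero. *)
Lemma scaling_automorphism (tau : 'End(V)) :
  scaling tau (fun i j => y i * (x j)^-1) x (fun j => (x j)^-1 ^+ 2) y ->
  forall u v, tau (br u v) = br (tau u) (tau v).
Proof.
move=> [tX tY tZ tW].
have L u v w : listed q X Y Z u v w -> br (tau u) (tau v) = tau (br u v).
  move=> luv; rewrite (presented_bracket brP luv); case: (luv).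
    move=> [i [[|j] [i2 jq [uE vE wE]]]] //; subst u v w.
    rewrite tX // tY // tW // linearZl_LR linearZr_LR /= (presented_bracket brP luv).
    by rewrite scalerA mulfVK ?x0.
  move=> [[|j] jq [uE vE wE]] //; subst u v w.
  have := tX 0%N j isT jq; have := tX 1%N j isT jq.
  rewrite mul0n mul1n add0n [(q + j.+1)%N]addnC => -> ->.
  rewrite tZ // linearZl_LR linearZr_LR /= (presented_bracket brP luv) scalerA.
  by congr (_ *: _); rewrite mulrACA y01 mul1r expr2.
apply: (basis_ind2 sb) => [v|u|a u v w hu hv|a u v w hu hv|u v us vs].
- by rewrite linear0 !linear0l linear0.
- by rewrite !linear0.
- by rewrite linearDl linearZl_LR !linearP /= hu hv linearDl linearZl_LR.
- by rewrite !linearP /= hu hv.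
have eig z : z \in XYZ q X Y Z -> exists c, tau z = c *: z.
  by case/XYZP => [i j i2 jq|j jq|j jq|i i2]; rewrite ?tX ?tY ?tZ ?tW //; eexists.
have [E|[w [/L //|/L E]]] := bracket_cases brP us vs.
  have [c ->] := eig u us; have [c' ->] := eig v vs.
  by rewrite linearZl_LR linearZr_LR /= E linear0 !scaler0.
by rewrite (bracket_antisym brA) linearN /= -E -(bracket_antisym brA).
Qed.

Lemma scaling_hyperbolic (tau : 'End(V)) :
  scaling tau (fun i j => y i * (x j)^-1) x (fun j => (x j)^-1 ^+ 2) y ->
  hyperbolic tau.
Proof.
move=> [tX tY tZ tW]; apply: (hyperbolic_of_eigenbasis sb).
move=> _ /XYZP[i j i2 jq|j jq|j jq|i i2].
- exists (y i * (x j)^-1); first exact: tX.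
  apply: contra (xy_neq i2 jq) => /eqP E; apply/eqP.
  by rewrite -[RHS]mul1r -E; field; exact: x0.
- by exists (x j); [exact: tY|exact: x2_neq1].
- exists ((x j)^-1 ^+ 2); first exact: tZ.
  apply: contra (x2_neq1 jq) => /eqP E; apply/eqP.
  (* As x_j^2 is nonnegative, its square being 1 forces x_j^2 = 1. *)
  have {}E : (x j ^+ 2) ^+ 2 = 1.
    by rewrite -[LHS]mul1r -{1}E; field; exact: x0.
  by have := sqr_ge0 (x j); nra.
- by exists (y i); [exact: tW|exact: y2_neq1].
Qed.

Lemma anosov_of_units : anosov br.
Proof.
split; first exact: (lie_bracket_presented q2 brA brP).
have [tau tauE] := scaling_exists
  (fun i j => y i * (x j)^-1) x (fun j => (x j)^-1 ^+ 2) y.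
(* The inverse eigenvalues are written as y_i^-1 x_j and x_j^2, the shape in which
   [integral_comb_scaling] applies. *)
have [sigma sigmaE] := scaling_exists
  (fun i j => (y i)^-1 * x j) (fun j => (x j)^-1) (fun j => x j ^+ 2)
  (fun i => (y i)^-1).
have ts : forall u, tau (sigma u) = u.
  apply: (scaling_comp_id tauE); last 1 first.
  - exact: y0.
  - case: sigmaE => sX sY sZ sW; split=> // *;
      rewrite ?invfM ?exprVn ?invrK //; auto.
  - by move=> i j i2 jq; rewrite mulf_neq0 ?invr_eq0 ?x0 ?y0.
  - exact: x0.
  - by move=> j jq; rewrite expf_neq0 // invr_eq0 x0.
have st : forall u, sigma (tau u) = u.
  apply: (scaling_comp_id sigmaE); last 1 first.
  - by move=> i i2; rewrite invr_eq0 y0.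
  - case: tauE => tX tY tZ tW; split=> // *;
      rewrite ?invfM ?exprVn ?invrK //; auto.
  - by move=> i j i2 jq; rewrite mulf_neq0 ?invr_eq0 ?x0 ?y0.
  - by move=> j jq; rewrite invr_eq0 x0.
  - by move=> j jq; rewrite expf_neq0 // x0.
have xV := Zfun_inv xf; have yV := Zfun_inv yg.
have xI := Zfun_id q x; have yI := Zfun_id 2 y.
have [b [bb bs']] : exists b : (\dim {:V}).-tuple V,
    basis_of fullv b /\ b = s' :> seq V.
  apply: basis_of_span; last exact: integral_basis_span.
  by rewrite size_XYZ (dim_presented brP).
exists tau; split.
- split; last exact: scaling_automorphism.
  by exists sigma.
- exact: scaling_hyperbolic.
exists b; first exact: integral_basis_Zbasis.
apply: (integral_unimodular_of_inverse bb ts) => u;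
  rewrite -[_ \in _]/(u \in tval b) bs' => us.
  apply: integral_comb_lattice => //.
  apply: (integral_comb_scaling tauE) => //; first exact: Zfun_sqr.
  exact: integral_basis_comb.
apply: integral_comb_lattice => //.
apply: (integral_comb_scaling sigmaE) => //; first exact: Zfun_sqr.
exact: integral_basis_comb.
Qed.

End Lattice.

(** * Choice of the units *)

Theorem mainTheorem4 (R : realType) (q : nat) (hq : (2 <= q)%N)
    (V : vectType R) (br : {bilinear V -> V -> V}) (X Y Z : nat -> V)
    (hbr : alternating br) (hXYZ : presented q br X Y Z) :
  [/\ lie_bracket br, nilpotent_of_step br 2, anosov br
    & of_type br [:: 3 * q; q + 2]%N].
Proof.
split; [exact: (lie_bracket_presented hq hbr hXYZ)
  |exact: (nilpotent_presented hq hbr hXYZ)| |exact: (type_presented hq hbr hXYZ)].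
have [x [f [xf x2]]] := totally_real_unit_exists R hq.
(* B exceeds every |x_j| and every |x_j|^-1, so y_0 > B makes y_0 larger and y_1 = 1 / y_0 smaller
   than all the |x_j|. *)
pose B : R := 1 + \sum_(j < q) (`|x j| + `|x j|^-1).
have Bge (j : nat) : (j < q)%N -> `|x j| + `|x j|^-1 <= B - 1.
  move=> jq; rewrite /B (bigD1 (Ordinal jq)) //= [1 + _]addrC addrK lerDl.
  by apply: sumr_ge0 => i _; rewrite addr_ge0 ?invr_ge0.
have B1 : 1 <= B.
  by rewrite /B lerDl; apply: sumr_ge0 => i _; rewrite addr_ge0 ?invr_ge0.
have [y [g [yg y01 /andP[y1 y1'] y0]]] := large_quadratic_unit_exists B.
apply: (anosov_of_units hq hbr hXYZ xf yg) => //.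
- by case=> [|[|i]] // _; apply/eqP; nra.
- move=> i j i2 jq; rewrite -[x j ^+ 2]real_normK ?num_real //.
  have := Bge j jq; have x0 := unit_roots_neq0 xf jq.
  have n0 : 0 < `|x j| by rewrite normr_gt0.
  have : `|x j| * `|x j|^-1 = 1 by rewrite divff // gt_eqF.
  have : 0 < `|x j|^-1 by rewrite invr_gt0.
  move: n0; move: `|x j|^-1 `|x j| => z w w0 z0 wz le.
  case: i i2 => [|[|i]] // _; apply/eqP => E; first by nra.
  (* Since y_1 > 0, equal squares give y_1 = |x_j|, whence y_0 = |x_j|^-1 < B, a contradiction. *)
  have {}E : y 1%N = w by nra.
  by have : y 0%N = z; nra.
Qed.
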